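(* For every real $a>1$, the function $d_a$ is a metric on $\mathcal{X}$.
   Context: $\mathbf{N}=\{1,2,3,\dots\}$. $\mathcal{X}=\{\{n_1,n_2\}\subset\mathbf{N}\mid \gcd(n_1,n_2)=1\}$ is the set of unordered pairs of coprime natural numbers, regarded as sets; $n_1=n_2=1$ is allowed, giving $\{1,1\}=\{1\}\in\mathcal{X}$. For $\mathbf{n}=\{n_1,n_2\}\in\mathcal{X}$ and $m\in\mathbf{N}$ let $$q_{\mathbf{n}}(m)=\min\{|x|+|y| \mid m=n_1x+n_2y,\ x,y\in\mathbf{Z}\},$$ and for $\mathbf{m},\mathbf{n}\in\mathcal{X}$ let $q_{\mathbf{n}}(\mathbf{m})=\max_{m\in\mathbf{m}}q_{\mathbf{n}}(m)$. For $a>1$, $$d_a(\mathbf{m},\mathbf{n})=\log_a\bigl(\max\{q_{\mathbf{n}}(\mathbf{m}),q_{\mathbf{m}}(\mathbf{n})\}\bigr),\qquad \mathbf{m},\mathbf{n}\in\mathcal{X}.$$ *)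

(* Defs.v *)
From mathcomp Require Import all_boot all_order all_algebra finmap.
From mathcomp Require Import boolp reals exp.

Set Implicit Arguments.
Unset Strict Implicit.
Unset Printing Implicit Defensive.

Import Order.TTheory GRing.Theory Num.Theory.

Local Open Scope fset_scope.
Local Open Scope ring_scope.

(* [fset n1; n2] is unordered and collapses to a singleton when n1 = n2, which
   coprimality allows only for n1 = n2 = 1. *)
Definition is_coprime_pair (S : {fset nat}) : bool :=
  `[< exists n1 n2 : nat,
      [/\ (0 < n1)%N, (0 < n2)%N, coprime n1 n2 & S = [fset n1; n2]] >].

Definition coprime_pair : Type := {S : {fset nat} | is_coprime_pair S}.

(* k = |x| + |y| for some representation m = n1 x + n2 y, where n = {n1, n2}. *)
Definition rep_length (n : coprime_pair) (m k : nat) : bool :=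
  `[< exists (n1 n2 : nat) (x y : int),
      [/\ val n = [fset n1; n2],
          m%:Z = n1%:Z * x + n2%:Z * y
        & k = (`|x| + `|y|)%N] >].

Lemma rep_length_ex (n : coprime_pair) (m : nat) : exists k, rep_length n m k.
Proof.
case: n => S S_pair; have /asboolP[n1 [n2 [_ _ co_n S_eq]]] := S_pair.
have [u [v Duv]] := Bezoutz n1%:Z n2%:Z.
exists (absz (u * m%:Z)%R + absz (v * m%:Z)%R)%N; apply/asboolP.
exists n1, n2, (u * m%:Z), (v * m%:Z); split=> //.
rewrite !mulrA ![_%:Z * _]mulrC -mulrDl Duv.
by rewrite /gcdz !absz_nat (eqP co_n) mul1r.
Qed.

Definition q (n : coprime_pair) (m : nat) : nat := ex_minn (rep_length_ex n m).

Definition qmax (n m : coprime_pair) : nat := \max_(i <- val m) q n i.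

Definition log {R : realType} (a x : R) : R := ln x / ln a.

Definition dist {R : realType} (a : R) (m n : coprime_pair) : R :=
  log a (maxn (qmax n m) (qmax m n))%:R.

Definition is_metric {R : realType} (T : Type) (d : T -> T -> R) : Prop :=
  [/\ forall x y, 0 <= d x y,
      forall x y, d x y = 0 <-> x = y,
      forall x y, d x y = d y x
    & forall x y z, d x z <= d x y + d y z].

(* Main.v *)
(** Write [Q(m, n)] for [max (q_n(m)) (q_m(n))], so that [dist a m n] is
    [log_a Q(m, n)]. Substituting shortest representations of the elements of
    [m] over [n] into a shortest representation of [l] over [m] gives
    [q_n(l) <= q_n(m) q_m(l)]; thus [Q] is submultiplicative, which is the
    triangle inequality after taking logarithms. Since all elements are
    positive, [q_n(m) >= 1], with equality only if [m] is an element of [n];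
    hence [Q(m, n) = 1] exactly when each of [m], [n] contains the other. *)

Require Import Defs.
From mathcomp Require Import all_boot all_order all_algebra.
From mathcomp Require Import reals.
From mathcomp Require Import finmap boolp exp zify ring.

Import Order.TTheory GRing.Theory Num.Theory.

Local Open Scope ring_scope.

Lemma fset2_eqP (a b c d : nat) : [fset a; b]%fset = [fset c; d]%fset ->
  (a = c /\ b = d) \/ (a = d /\ b = c).
Proof.
move=> /fsetP eq_abcd.
have := eq_abcd a; have := eq_abcd b; have := eq_abcd c; have := eq_abcd d.
rewrite !inE; lia.
Qed.

Lemma coprime_pairP (n : coprime_pair) :
  exists n1 n2 : nat, [/\ (0 < n1)%N, (0 < n2)%N & val n = [fset n1; n2]%fset].
Proof.
by case: n => S S_pair; have /asboolP[n1 [n2 [? ? _ ?]]] := S_pair;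
  exists n1, n2.
Qed.

Lemma coprime_pair_gt0 (n : coprime_pair) (i : nat) : i \in val n -> (0 < i)%N.
Proof.
by have [n1 [n2 [n1_gt0 n2_gt0 ->]]] := coprime_pairP n; rewrite !inE;
  case/orP=> /eqP->.
Qed.

(** [rep_length] lets each representation choose its own ordering of the pair. Reversing the
    ordering only exchanges [x] and [y], which preserves the length, so one ordering can be fixed
    throughout. *)
Lemma rep_lengthE (n : coprime_pair) (n1 n2 m k : nat) :
    val n = [fset n1; n2]%fset ->
  rep_length n m k <-> exists x y : int,
    m%:Z = n1%:Z * x + n2%:Z * y /\ k = (`|x| + `|y|)%N.
Proof.
move=> n_eq; split=> [/asboolP[p1 [p2 [x [y [n_eq' -> ->]]]]] | [x [y [? ?]]]].
  move: n_eq'; rewrite n_eq => /fset2_eqP[[-> ->]|[-> ->]]; first by exists x, y.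
  by exists y, x; split; [rewrite addrC | rewrite addnC].
by apply/asboolP; exists n1, n2, x, y.
Qed.

Lemma q_le (n : coprime_pair) (m k : nat) : rep_length n m k -> (q n m <= k)%N.
Proof. by move=> nmk; rewrite /q; case: ex_minnP => j _; apply. Qed.

Lemma qP (n : coprime_pair) (m : nat) : rep_length n m (q n m).
Proof. by rewrite /q; case: ex_minnP. Qed.

(** Length 0 forces both coefficients, hence [m], to vanish. *)
Lemma q_gt0 (n : coprime_pair) (m : nat) : (0 < m)%N -> (0 < q n m)%N.
Proof.
have [n1 [n2 [_ _ n_eq]]] := coprime_pairP n.
by have /(rep_lengthE _ _ _ _ _ n_eq)[x [y [m_eq q_eq]]] := qP n m; nia.
Qed.

Lemma q_le1 (n : coprime_pair) (m : nat) :
  (0 < m)%N -> (q n m <= 1)%N = (m \in val n).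
Proof.
move=> m_gt0; have [n1 [n2 [n1_gt0 n2_gt0 n_eq]]] := coprime_pairP n.
apply/idP/idP => [q_m_le1|].
  have /(rep_lengthE _ _ _ _ _ n_eq)[x [y [m_eq q_eq]]] := qP n m.
  (* At most one coefficient is nonzero, and it lies in {-1, 0, 1}; positivity of [m] leaves only 1,
     so [m] is [n1] or [n2]. *)
  rewrite n_eq !inE; have [x0|y0] : x = 0 \/ y = 0 by lia.
    apply/orP; right; subst x.
    have [y1|y_le0] : y = 1 \/ y <= 0 by lia.
      by subst y; lia.
    nia.
  apply/orP; left; subst y.
  have [x1|x_le0] : x = 1 \/ x <= 0 by lia.
    by subst x; lia.
  nia.
rewrite n_eq !inE => /orP[] /eqP->; apply/q_le/(rep_lengthE _ _ _ _ _ n_eq).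
  by exists 1, 0; split; [ring | ].
by exists 0, 1; split; [ring | ].
Qed.

Lemma q_le_qmax (n m : coprime_pair) (i : nat) :
  i \in val m -> (q n i <= qmax n m)%N.
Proof. by move=> m_i; rewrite /qmax; apply: leq_bigmax_seq. Qed.

Lemma qmax_leP (n m : coprime_pair) (k : nat) :
  reflect {in val m, forall i, (q n i <= k)%N} (qmax n m <= k)%N.
Proof.
apply: (iffP (bigmax_leqP_seq _ _ _ _)) => le_k i; first by move/le_k; apply.
by move=> m_i _; apply: le_k.
Qed.

Lemma qmax_gt0 (n m : coprime_pair) : (0 < qmax n m)%N.
Proof.
have [m1 [m2 [m1_gt0 _ m_eq]]] := coprime_pairP m.
apply: leq_trans (q_gt0 n _ m1_gt0) (q_le_qmax _ _ _ _).
by rewrite m_eq !inE eqxx.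
Qed.

Lemma qmax_le1 (n m : coprime_pair) :
  (qmax n m <= 1)%N = (val m `<=` val n)%fset.
Proof.
apply/qmax_leP/fsubsetP => m_n i m_i; have i_gt0 := coprime_pair_gt0 _ _ m_i.
  by rewrite -q_le1 ?m_n.
by rewrite q_le1 ?m_n.
Qed.

Lemma q_submul (n m : coprime_pair) (l : nat) :
  (q n l <= qmax n m * q m l)%N.
Proof.
have [n1 [n2 [_ _ n_eq]]] := coprime_pairP n.
have [m1 [m2 [_ _ m_eq]]] := coprime_pairP m.
have /(rep_lengthE _ _ _ _ _ m_eq)[x [y [l_eq ->]]] := qP m l.
have m1_le : (q n m1 <= qmax n m)%N by apply: q_le_qmax; rewrite m_eq !inE eqxx.
have m2_le : (q n m2 <= qmax n m)%N.
  by apply: q_le_qmax; rewrite m_eq !inE eqxx orbT.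
have /(rep_lengthE _ _ _ _ _ n_eq)[a [b [m1_eq q1_eq]]] := qP n m1.
have /(rep_lengthE _ _ _ _ _ n_eq)[c [d [m2_eq q2_eq]]] := qP n m2.
rewrite q1_eq in m1_le; rewrite q2_eq in m2_le.
(* These are the coefficients of [n1] and [n2] after substituting [m1 = n1 a + n2 b] and
   [m2 = n1 c + n2 d] into [l = m1 x + m2 y]. *)
apply: (@leq_trans (`|(a * x + c * y)%R| + `|(b * x + d * y)%R|)).
  apply/q_le/(rep_lengthE _ _ _ _ _ n_eq).
  exists (a * x + c * y), (b * x + d * y); split=> //.
  by rewrite l_eq m1_eq m2_eq; ring.
have absz_lin (u v : int) :
    (`|(u * x + v * y)%R| <= `|u| * `|x| + `|v| * `|y|)%N.
  by rewrite -!abszM; lia.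
apply: leq_trans (leq_add (absz_lin a c) (absz_lin b d)) _.
(* Regrouped by [x] and [y], the bound is [(|a| + |b|) |x| + (|c| + |d|) |y|], and both brackets are
   at most [qmax n m]. *)
by rewrite addnACA -!mulnDl mulnDr leq_add // leq_mul2r ?m1_le ?m2_le orbT.
Qed.

Lemma qmax_submul (n m l : coprime_pair) :
  (qmax n l <= qmax n m * qmax m l)%N.
Proof.
apply/qmax_leP => i l_i; apply: leq_trans (q_submul n m i) _.
by rewrite leq_mul2l q_le_qmax ?orbT.
Qed.

Theorem proposition2p2 (R : realType) (a : R) (ha : 1 < a) :
  is_metric (dist a).
Proof.
have lna_gt0 : 0 < ln a by rewrite ln_gt0.
pose Q m n := maxn (qmax n m) (qmax m n).
have Q_gt0 m n : (0 < Q m n)%N by rewrite leq_max qmax_gt0.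
have QR_gt0 m n : 0 < (Q m n)%:R :> R by rewrite ltr0n.
split=> [m n|m n|m n|l m n].
- by rewrite divr_ge0 ?(ltW lna_gt0) // ln_ge0 // ler1n Q_gt0.
(* As [Q] is at least 1, its logarithm vanishes iff [Q <= 1]; in this form the maximum splits into
   the two inclusions between [m] and [n]. *)
- have -> : (dist a m n = 0) <-> (Q m n <= 1)%N.
    split=> [/eqP|Q_le1].
      rewrite mulf_eq0 invr_eq0 (gt_eqF lna_gt0) orbF ln_eq0 ?QR_gt0 //.
      by rewrite pnatr_eq1 => /eqP Q_eq1; rewrite /Q Q_eq1.
    have Q_eq1 : Q m n = 1%N by apply/eqP; rewrite eqn_leq Q_le1 Q_gt0.
    by rewrite /dist /log -/(Q m n) Q_eq1 ln1 mul0r.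
  rewrite geq_max !qmax_le1; split=> [|->]; last by rewrite fsubset_refl.
  by rewrite -eqEfsubset => /eqP/val_inj.
- by rewrite /dist maxnC.
- rewrite /dist /log -mulrDl ler_pM2r ?invr_gt0 //.
  rewrite -lnM ?posrE ?QR_gt0 // ler_ln ?posrE ?mulr_gt0 ?QR_gt0 //.
  (* Each direction of [Q l n] factors through [m] separately: the first uses the left components of
     [Q l m] and [Q m n], the second the right ones. *)
  rewrite -natrM ler_nat geq_max; apply/andP; split.
    apply: leq_trans (qmax_submul n m l) _.
    by rewrite mulnC leq_mul ?leq_maxl.
  apply: leq_trans (qmax_submul l m n) _.
  by rewrite leq_mul ?leq_maxr.
Qed.
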